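(* Let $\mu,\delta\in\mathbb{R}$ and $\sigma,\alpha,\theta>0$, and let $Y=\{Y_t\}_{t\ge0}$ be a Lévy process on $\mathbb{R}$ generated by the Variance-Gamma model with parameters $(\mu,\delta,\sigma,\alpha,\theta)$. Then the characteristic exponent of $Y$ has the representation $$\varphi(\xi,1)=-\log E\left[e^{i\xi Y_1}\right]=-i\mu\xi+\int_{-\infty}^{+\infty}\left(1-e^{-i\xi u}\right)\Pi(u)\,du,$$ where $\Pi(u)$ is the Lévy density of $Y$: $$\Pi(u)=\alpha\left(\frac{1_{\{u>0\}}}{u}e^{-x_1u}+\frac{1_{\{u<0\}}}{|u|}e^{-x_2u}\right),$$ with $$x_1=\frac{\delta}{\sigma^2}+\sqrt{\frac{\delta^2}{\sigma^4}+\frac{2}{\theta\sigma^2}},\qquad x_2=\frac{\delta}{\sigma^2}-\sqrt{\frac{\delta^2}{\sigma^4}+\frac{2}{\theta\sigma^2}},$$ and $\Pi$ satisfies $$\int_{-\infty}^{+\infty}\Pi(u)\,du=+\infty\qquad\text{and}\qquad\int_{-\infty}^{+\infty}\min(1,|u|)\,\Pi(u)\,du<+\infty.$$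
   Context: The Lévy process generated by the Variance-Gamma (VG) model with parameters $(\mu,\delta,\sigma,\alpha,\theta)$, where $\mu,\delta\in\mathbb{R}$ and $\sigma,\alpha,\theta>0$, is the Lévy process $Y$ with characteristic function $$E\left[e^{i\xi Y_t}\right]=\frac{e^{it\mu\xi}}{\left(1-i\delta\theta\xi+\frac12\sigma^2\theta\xi^2\right)^{t\alpha}},\qquad \xi\in\mathbb{R},\ t\ge0.$$ The characteristic exponent is $\varphi(\xi,t)=-\log E[e^{i\xi Y_t}]$. The Lévy density of $Y$ is the density of its Lévy measure, i.e. it gives the arrival rate of jumps of size $u$.
   Formalization: The Lévy density of Y (arrival rate of jumps of size u) is stated as Π(-u), not Π(u): with the displayed kernel exp(-iξu) and these x_1, x_2 the claim for Π(u) fails unless δ=0, since ∫uΠ(u)du = -αδθ while E[Y_1]-μ = αδθ. *)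

(* Defs.v *)
From HB Require Import structures.
From mathcomp Require Import all_boot all_order all_algebra.
From mathcomp Require Import all_classical all_reals all_analysis.

Set Implicit Arguments.
Unset Strict Implicit.
Unset Printing Implicit Defensive.

Import Order.TTheory GRing.Theory Num.Theory.
Import numFieldNormedType.Exports.
From mathcomp Require Import complex.

Local Open Scope classical_set_scope.
Local Open Scope ring_scope.
Local Open Scope complex_scope.

Section complex_functions.
Context {R : realType}.
Implicit Types (z : R[i]) (a : R).

Definition Cexp z : R[i] := (expR (Re z))%:C * (cos (Im z) +i* sin (Im z)).

(* The principal argument of z != 0, with values in ]-pi, pi]. *)
Definition Carg z : R :=
  let r := Num.sqrt (Re z ^+ 2 + Im z ^+ 2) in
  if 0 <= Im z then acos (Re z / r) else - acos (Re z / r).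

Definition Clog z : R[i] :=
  ln (Num.sqrt (Re z ^+ 2 + Im z ^+ 2)) +i* Carg z.

Definition Cpow z a : R[i] := Cexp (a%:C * Clog z).

(* The logarithm of a nowhere vanishing characteristic function f is its
   distinguished logarithm: the unique continuous g with g 0 = 0 and
   exp g = f. The principal logarithm of f would be discontinuous in general. *)
Definition is_dlog (f g : R -> R[i]) : Prop :=
  [/\ continuous (fun x => Re (g x)), continuous (fun x => Im (g x)),
      g 0 = 0 & forall x, Cexp (g x) = f x].

Definition dlog (f : R -> R[i]) : R -> R[i] := xget (fun=> 0) (is_dlog f).

End complex_functions.

Section complex_integral.
Context d (T : measurableType d) (R : realType).
Variable mu : {measure set T -> \bar R}.

Definition Cintegrable (f : T -> R[i]) : Prop :=
  mu.-integrable setT (fun x => (Re (f x))%:E) /\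
  mu.-integrable setT (fun x => (Im (f x))%:E).

Definition Cintegral (f : T -> R[i]) : R[i] :=
  (\int[mu]_x Re (f x))%R +i* (\int[mu]_x Im (f x))%R.

End complex_integral.

Section levy_processes.
Context d (T : measurableType d) (R : realType) (P : probability T R).

Definition cf (X : T -> R) (xi : R) : R[i] :=
  Cintegral P (fun w => Cexp ('i * (xi * X w)%:C)).

(* Taking some of the B i to be setT gives the product rule for subfamilies. *)
Definition independent_family n (X : 'I_n -> T -> R) : Prop :=
  forall B : 'I_n -> set R, (forall i, measurable (B i)) ->
    P (\bigcap_(i in [set: 'I_n]) X i @^-1` B i) =
    (\prod_(i < n) P (X i @^-1` B i))%E.

(* Processes are indexed by R, but only the times t >= 0 are constrained. *)
Record is_levy_process (Y : R -> {RV P >-> R}) : Prop := IsLevyProcess {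
  levy_start : {ae P, forall w, Y 0 w = 0};
  levy_independent_increments : forall (n : nat) (t : nat -> R),
    0 <= t 0%N -> (forall i, t i <= t i.+1) ->
    independent_family (fun (i : 'I_n) w => Y (t i.+1) w - Y (t i) w);
  levy_stationary_increments : forall s t : R, 0 <= s -> 0 <= t ->
    forall B : set R, measurable B ->
      P [set w | B (Y (s + t) w - Y s w)] = P [set w | B (Y t w - Y 0 w)];
  levy_stochastic_continuity : forall s e : R, 0 <= s -> 0 < e ->
    P [set w | e < `|Y t w - Y s w|]
      @[t --> within [set t | 0 <= t] (nbhs s)] --> 0%E;
  levy_cadlag : {ae P, forall w,
    (forall t : R, 0 <= t -> Y s w @[s --> t^'+] --> Y t w) /\
    (forall t : R, 0 < t -> exists l : R, Y s w @[s --> t^'-] --> l)}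
}.

Definition is_VG_process (mu delta sigma alpha theta : R)
    (Y : R -> {RV P >-> R}) : Prop :=
  is_levy_process Y /\
  forall t xi : R, 0 <= t ->
    cf (Y t) xi =
    Cexp ('i * (t * mu * xi)%:C) /
    Cpow (1 - 'i * (delta * theta * xi)%:C
            + (2^-1 * sigma ^+ 2 * theta * xi ^+ 2)%:C) (t * alpha).

Definition char_exponent (Y : R -> {RV P >-> R}) (xi t : R) : R[i] :=
  - dlog (cf (Y t)) xi.

(* The Levy measure is the measure of the Levy-Khintchine triplet (b, c, nu),
   in the standard normalization exp(i xi u), for which nu A is the expected
   number of jumps of size u \in A per unit of time. *)
Definition is_levy_measure (Y : R -> {RV P >-> R})
    (nu : {measure set (measurableTypeR R) -> \bar R}) : Prop :=
  [/\ nu [set 0] = 0%E,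
      (\int[nu]_u (Num.min 1 (u ^+ 2))%:E < +oo)%E &
      exists b c : R, 0 <= c /\
        forall t xi : R, 0 <= t ->
          cf (Y t) xi =
          Cexp (t%:C * ('i * (b * xi)%:C - (2^-1 * c * xi ^+ 2)%:C
            + Cintegral nu (fun u : R => Cexp ('i * (xi * u)%:C) - 1
                - 'i * (xi * u * \1_[set v : R | `|v| <= 1] u)%:C)))].

Definition is_levy_density (Y : R -> {RV P >-> R}) (p : R -> R) : Prop :=
  [/\ measurable_fun setT p, (forall u, 0 <= p u) &
      exists2 nu : {measure set (measurableTypeR R) -> \bar R},
        is_levy_measure Y nu &
        forall A : set R, measurable A ->
          nu A = (\int[lebesgue_measure]_(u in A) (p u)%:E)%E].

End levy_processes.

Section VG_density.
Context {R : realType}.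
Variables delta sigma alpha theta : R.

Definition VG_x1 : R :=
  delta / sigma ^+ 2
  + Num.sqrt (delta ^+ 2 / sigma ^+ 4 + 2 / (theta * sigma ^+ 2)).

Definition VG_x2 : R :=
  delta / sigma ^+ 2
  - Num.sqrt (delta ^+ 2 / sigma ^+ 4 + 2 / (theta * sigma ^+ 2)).

Definition VG_Pi (u : R) : R :=
  alpha * (\1_[set v : R | 0 < v] u / u * expR (- VG_x1 * u)
           + \1_[set v : R | v < 0] u / `|u| * expR (- VG_x2 * u)).

End VG_density.

(* Main.v *)
(* The polynomial 1 - i delta theta xi + sigma^2 theta xi^2 / 2 factors as
   (1 + i xi / x1) (1 + i xi / x2), with x2 < 0 < x1. The principal logarithm
   of each factor is a Frullani integral: the half-line integrals of
   sin (xi u) e^(- a u) / u and (1 - cos (xi u)) e^(- a u) / u are atan (xi / a)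
   and ln (1 + (xi / a)^2) / 2, as one sees by differentiating in xi. Since x1
   and x2 have opposite signs, the two arguments add up to a number in
   ]-pi/2, pi/2[, so the principal logarithm of the product is the sum of the
   logarithms. It is continuous in xi, hence gives the distinguished logarithm
   of the characteristic function, and the same integrals give the
   Levy-Khintchine formula with jump density u |-> Pi (- u). *)

From HB Require Import structures.
Require Import Defs.
From mathcomp Require Import all_boot all_order all_algebra.
From mathcomp Require Import all_classical all_reals all_analysis.
From mathcomp Require Import measurable_realfun.
From mathcomp Require Import ring lra.

Import Order.TTheory GRing.Theory Num.Theory.
Import numFieldNormedType.Exports.
From mathcomp Require Import complex.

Local Open Scope classical_set_scope.
Local Open Scope ring_scope.
Local Open Scope complex_scope.

Set Implicit Arguments.
Unset Strict Implicit.
Unset Printing Implicit Defensive.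

(** * Complex exponential, distinguished logarithm and principal logarithm *)

Section complex_facts.
Context {R : realType}.
Implicit Types (z w : R[i]) (x y : R).

Lemma imaginaryE : 'i%R = (0 +i* 1) :> R[i].
Proof. by rewrite -complexiE. Qed.

Lemma addcE x y (x' y' : R) :
  (x +i* y) + (x' +i* y') = ((x + x') +i* (y + y')) :> R[i].
Proof. by []. Qed.

Lemma mulcE x y (x' y' : R) :
  (x +i* y) * (x' +i* y') = ((x * x' - y * y') +i* (x * y' + y * x')) :> R[i].
Proof. by []. Qed.

Lemma oppcE x y : - (x +i* y) = ((- x) +i* (- y)) :> R[i].
Proof. by []. Qed.

Lemma oneCE : 1 = (1 +i* 0) :> R[i].
Proof. by []. Qed.

Lemma CexpE x y : Cexp (x +i* y) = (expR x * cos y) +i* (expR x * sin y).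
Proof. by rewrite /Cexp mulcE /= !mul0r subr0 addr0. Qed.

Lemma CexpD z w : Cexp (z + w) = Cexp z * Cexp w.
Proof.
case: z w => [x y] [x' y']; rewrite addcE !CexpE mulcE expRD cosD sinD.
by congr (_ +i* _); ring.
Qed.

Lemma Cexp0 : Cexp 0 = 1 :> R[i].
Proof. by rewrite CexpE expR0 cos0 sin0 mulr0 mulr1. Qed.

Lemma CexpN z : Cexp (- z) = (Cexp z)^-1.
Proof.
have Hz : Cexp (- z) * Cexp z = 1 by rewrite -CexpD addNr Cexp0.
have z0 : Cexp z != 0.
  by apply/eqP => z0; move/eqP: Hz; rewrite z0 mulr0 eq_sym oner_eq0.
by apply: (mulIf z0); rewrite Hz mulVf.
Qed.

Lemma Cexp_iE x : Cexp ('i%R * x%:C) = cos x +i* sin x :> R[i].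
Proof.
by rewrite imaginaryE mulcE CexpE !mul0r mul1r subr0 add0r expR0 !mul1r.
Qed.

(** Comparing moduli gives equal real parts. The difference [k] of the imaginary parts is
    continuous, vanishes at 0 and satisfies cos k = 1, so it takes values in a discrete set and
    cannot leave 0. *)
Lemma is_dlog_unique {f : R -> R[i]} {g h : R -> R[i]} :
  is_dlog f g -> is_dlog f h -> g = h.
Proof.
move=> [rg ig g0 eg] [rh ih h0 eh]; apply/funext => x.
pose k t := Im (g t) - Im (h t).
have expk t : Re (g t) = Re (h t) /\ cos (k t) = 1.
  have := eg t; rewrite -eh.
  rewrite /k; case: (g t) (h t) => [a b] [c e]; rewrite !CexpE /= => -[E1 E2].
  have ac : a = c.
    (* The squared modulus of the exponential depends on the real part only. *)
    have : expR a ^+ 2 = expR c ^+ 2.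
      have H u v : expR u ^+ 2 = (expR u * cos v) ^+ 2 + (expR u * sin v) ^+ 2 :> R.
        by rewrite !exprMn -mulrDr cos2Dsin2 mulr1.
      by rewrite (H a b) E1 E2 -H.
    by rewrite -!expRM_natr => /expR_inj; lra.
  split => //; move: E1 E2; rewrite ac.
  move=> /(mulfI (lt0r_neq0 (expR_gt0 c))) E1.
  move=> /(mulfI (lt0r_neq0 (expR_gt0 c))) E2.
  by rewrite cosB E1 E2 -(cos2Dsin2 e); ring.
suff kx0 : k x = 0.
  have [Ex _] := expk x; move: Ex kx0; rewrite /k.
  by case: (g x) (h x) => [a b] [c e] /= -> /subr0_eq ->.
have ck : continuous k by move=> t; apply: cvgB; [exact: ig|exact: ih].
have k0 : k 0 = 0 by rewrite /k g0 h0 subrr.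
apply/eqP; apply: contrapT => /negP kx0.
(* Between 0 and x, |k| would take a value in ]0, pi[, where cos < 1. *)
pose m := Num.min `|k x| (pi / 2).
have pi0 := @pi_gt0 R.
have m0 : 0 < m by rewrite lt_min normr_gt0 kx0 divr_gt0.
have mpi : m <= pi / 2 by rewrite ge_min lexx orbT.
have mk : m <= `|k x| by rewrite ge_min lexx.
have cnk : continuous (fun t => `|k t|).
  by move=> t; apply: cvg_norm; exact: ck.
have [c _ Hc] : exists2 c, True & `|k c| = m.
  have [x0|x0] := leP 0 x.
    have [|c ? ?] := IVT x0 (continuous_subspaceT cnk) (v := m); last by exists c.
    by rewrite k0 normr0 ge_min le_max (ltW m0) mk orbT.
  have [|c ? ?] := IVT (ltW x0) (continuous_subspaceT cnk) (v := m); last by exists c.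
  by rewrite k0 normr0 ge_min le_max (ltW m0) mk orbT.
have [_] := expk c; rewrite -cos_norm Hc -(@cos0 R) => /cos_inj m00.
suff : m = 0 by move: m0 => /[swap] ->; rewrite ltxx.
by apply: m00; rewrite in_itv/= ?lexx ?ltW//; lra.
Qed.

Lemma dlogE (f g : R -> R[i]) : is_dlog f g -> dlog f = g.
Proof.
by move=> fg; exact: is_dlog_unique (xgetI _ fg) fg.
Qed.

(** The sign of sin t selects the branch of [Carg]; for negative t, evenness of the cosine makes the
    arc cosine equal to - t. *)
Lemma ClogE (r t : R) : 0 < r -> - (pi / 2) < t < pi / 2 ->
  Clog ((r * cos t) +i* (r * sin t)) = ln r +i* t.
Proof.
move=> r0 /andP[t1 t2]; have pi0 := @pi_gt0 R.
have nE : Num.sqrt ((r * cos t) ^+ 2 + (r * sin t) ^+ 2) = r.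
  by rewrite !exprMn -mulrDr cos2Dsin2 mulr1 sqrtr_sqr gtr0_norm.
rewrite /Clog /Carg /= nE; congr (_ +i* _).
rewrite (mulrC r (cos t)) mulfK ?gt_eqF// pmulr_rge0//.
have [t0|t0] := leP 0 t.
  by rewrite sin_ge0_pi ?cosK ?in_itv/= ?t0//; lra.
rewrite leNgt -[t]opprK sinN oppr_lt0 sin_gt0_pi /=; last by lra.
by rewrite cosN cosK ?in_itv/=//; lra.
Qed.

(** Together with the sine version, this is the polar form of 1 + i x: modulus sqrt (1 + x^2) and
    argument atan x. *)
Lemma mul_sqrt_cos_atan x : Num.sqrt (1 + x ^+ 2) * cos (atan x) = 1.
Proof.
by rewrite cos_atan divff// gt_eqF// sqrtr_gt0 ltr_pwDl// sqr_ge0.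
Qed.

Lemma mul_sqrt_sin_atan x : Num.sqrt (1 + x ^+ 2) * sin (atan x) = x.
Proof.
have c0 : cos (atan x) != 0.
  by apply/eqP => c0; move/eqP: (mul_sqrt_cos_atan x); rewrite c0 mulr0 eq_sym oner_eq0.
have -> : sin (atan x) = x * cos (atan x) by rewrite -{2}(atanK x) /tan mulfVK.
by rewrite mulrCA mul_sqrt_cos_atan mulr1.
Qed.

Lemma ln_sqrt x : 0 < x -> ln (Num.sqrt x) = 2^-1 * ln x :> R.
Proof.
move=> x0; have s0 : 0 < Num.sqrt x by rewrite sqrtr_gt0.
by rewrite -[in RHS](sqr_sqrtr (ltW x0)) lnXn//; lra.
Qed.

(** The argument of [Clog] is the product of 1 + i p and 1 + i q. Since p and q do not have the same
    strict sign, neither do their arc tangents, and the sum of these stays in ]-pi/2, pi/2[. *)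
Lemma Clog_mul (p q : R) : p * q <= 0 ->
  Clog ((1 - p * q) +i* (p + q)) =
  (2^-1 * ln (1 + p ^+ 2) + 2^-1 * ln (1 + q ^+ 2)) +i* (atan p + atan q).
Proof.
move=> pq; have pos u : 0 < 1 + u ^+ 2 :> R by rewrite ltr_pwDl// sqr_ge0.
have spos u : 0 < Num.sqrt (1 + u ^+ 2) :> R by rewrite sqrtr_gt0.
pose r := Num.sqrt (1 + p ^+ 2) * Num.sqrt (1 + q ^+ 2).
have -> : 1 - p * q = r * cos (atan p + atan q).
  by rewrite cosD mulrBr {1}/r mulrACA !mul_sqrt_cos_atan mulr1 /r mulrACA !mul_sqrt_sin_atan.
have -> : p + q = r * sin (atan p + atan q).
  rewrite sinD mulrDr {1}/r mulrACA mul_sqrt_cos_atan mul_sqrt_sin_atan mulr1.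
  by rewrite /r mulrACA mul_sqrt_cos_atan mul_sqrt_sin_atan mul1r.
have sgn (u : R) : (0 <= u -> 0 <= atan u) /\ (u <= 0 -> atan u <= 0).
  by split=> /le_atan; rewrite atan0.
have [p0 pn] := sgn p; have [q0 qn] := sgn q.
have := atan_gtNpi2 p; have := atan_ltpi2 p.
have := atan_gtNpi2 q; have := atan_ltpi2 q => q2 q1 p2 p1.
rewrite ClogE ?mulr_gt0//; last first.
  have [pq0|pq0] : 0 <= p /\ q <= 0 \/ p <= 0 /\ 0 <= q.
  - case: (ltgtP p 0) => p'; last 1 first.
    + by case: (leP 0 q) => q'; [right|left]; split; lra.
    + by right; split; nra.
    + by left; split; nra.
  - by move: (p0 pq0.1) (qn pq0.2); lra.
  - by move: (pn pq0.1) (q0 pq0.2); lra.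
by rewrite /r lnM ?posrE ?spos// !ln_sqrt.
Qed.

End complex_facts.

Import HBNNSimple.

(** * Integration against a measure with a density *)

Section measures_with_density.
Context d (T : measurableType d) (R : realType).
Variables (mu : {measure set T -> \bar R}) (p : T -> R).
Hypotheses (mp : measurable_fun setT p) (p0 : forall x, 0 <= p x).

(* The hypotheses are arguments so that the measure structure can be inferred
   outside of this section. *)
Definition density_measure of measurable_fun setT p & (forall x, 0 <= p x) :=
  fun A : set T => (\int[mu]_(x in A) (p x)%:E)%E.

Local Notation density := (density_measure mp p0).

Let density0 : density set0 = 0%E.
Proof. exact: integral_set0. Qed.

Let density_ge0 A : (0 <= density A)%E.
Proof. by apply: integral_ge0 => x _; rewrite lee_fin. Qed.

Let density_sigma_additive : semi_sigma_additive density.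
Proof.
move=> F mF tF mUF; rewrite /density_measure ge0_integral_bigcup//.
- by apply: is_cvg_ereal_nneg_natsum_cond => n _ _; exact: density_ge0.
- by apply/measurable_EFinP; exact: measurable_funTS.
- by move=> x _; rewrite lee_fin.
Qed.

HB.instance Definition _ := isMeasure.Build _ _ _
  density density0 density_ge0 density_sigma_additive.

(** Monotone convergence along simple functions reduces the claim to indicators, for which it is the
    definition of the measure. *)
Let ge0_integral_density (f : T -> \bar R) : measurable_fun setT f ->
  (forall x, 0 <= f x)%E ->
  (\int[density]_x f x = \int[mu]_x (f x * (p x)%:E))%E.
Proof.
move=> mf f0; pose h := nnsfun_approx measurableT mf.
have mh n : measurable_fun setT (fun x => (h n x)%:E).
  exact/measurable_EFinP/measurable_funP.
have mpE : measurable_fun setT (fun x => (p x)%:E) by exact/measurable_EFinP.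
have cvgh x : ((h n x)%:E @[n --> \oo] --> f x)%E.
  by apply: cvg_nnsfun_approx.
have -> : (\int[density]_x f x =
    lim (\int[density]_x (h n x)%:E @[n --> \oo]))%E.
  rewrite -monotone_convergence//.
  - by apply: eq_integral => x _; apply/esym/cvg_lim.
  - by move=> n x _; rewrite lee_fin.
  - by move=> x _ a b ab; rewrite lee_fin; exact/lefP/nd_nnsfun_approx.
have -> : (\int[mu]_x (f x * (p x)%:E) =
    lim (\int[mu]_x ((h n x)%:E * (p x)%:E) @[n --> \oo]))%E.
  rewrite -monotone_convergence//.
  - by apply: eq_integral => x _; apply/esym/cvg_lim => //; exact: cvgeZr.
  - by move=> n; exact: emeasurable_funM.
  - by move=> n x _; rewrite mule_ge0 ?lee_fin.
  - move=> x _ a b ab; rewrite lee_wpmul2r ?lee_fin//.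
    exact/lefP/nd_nnsfun_approx.
apply: congr_lim; apply/funext => n.
have ind0 y x : (0 <= (y * \1_(h n @^-1` [set y]) x)%:E)%E.
  exact: nnfun_muleindic_ge0.
have mind y : measurable_fun setT (fun x => (y * \1_(h n @^-1` [set y]) x)%:E).
  by apply/measurable_EFinP; exact: measurable_funM.
transitivity (\int[density]_x
    (\sum_(y \in range (h n)) (y * \1_(h n @^-1` [set y]) x)%:E))%E.
  by apply: eq_integral => x _; rewrite [in LHS]fimfunE -fsumEFin//.
rewrite ge0_integral_fsum//.
transitivity (\int[mu]_x (\sum_(y \in range (h n))
    (y * \1_(h n @^-1` [set y]) x)%:E * (p x)%:E))%E; last first.
  apply: eq_integral => x _; rewrite -ge0_mule_fsuml//.
  by rewrite fsumEFin// -(fimfunE _ x).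
rewrite ge0_integral_fsum//; last 2 first.
- by move=> y; exact: emeasurable_funM.
- by move=> y x _; apply: mule_ge0; [exact: ind0|rewrite lee_fin].
apply: eq_fsbigr => y _ /=.
have mhy : measurable (h n @^-1` [set y]) by [].
(* The simple function is nonnegative, so a negative y has empty preimage and both integrals are
   0. *)
have [y0|y0] := leP 0 y; last first.
  by rewrite !integral0_eq// => x _; rewrite preimage_nnfun0// indic0 mulr0 ?mul0e.
rewrite (@integralZl_indic _ _ _ _ _ measurableT (fun y => h n @^-1` [set y]))//.
rewrite integral_indic// setIT /= /density_measure integral_mkcond.
rewrite -ge0_integralZl//; last 2 first.
- by apply/(measurable_restrictT _ _).1 => //; exact: measurable_funTS.
- by move=> x _; rewrite patchE; case: ifP; rewrite ?lee_fin.
apply: eq_integral => x _; rewrite patchE indicE.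
by case: ifP => _; rewrite ?mulr1 ?mulr0 ?mule0 ?mul0e// EFinM.
by move=> y1; rewrite ltNge y0 in y1.
Qed.

(** Multiplication by the nonnegative [p] commutes with taking positive and negative parts, so both
    sides are [fine] of the same extended real difference, be it finite or not. *)
Lemma Rintegral_density (f : T -> R) : measurable_fun setT f ->
  (\int[density]_x f x = \int[mu]_x (f x * p x))%R.
Proof.
move=> mf; rewrite /Rintegral; congr fine.
have mfE : measurable_fun setT (fun x => (f x)%:E) by exact/measurable_EFinP.
rewrite integralE [RHS]integralE !ge0_integral_density//.
- congr (_ - _)%E; apply: eq_integral => x _.
  + by rewrite !funeposE -!EFin_max -EFinM maxr_pMl// mul0r.
  + by rewrite !funenegE -!EFinN -!EFin_max -EFinM maxr_pMl// mul0r mulNr.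
- exact: measurable_funeneg.
- exact: measurable_funepos.
Qed.

Lemma ge0_integral_density_EFin (f : T -> R) : measurable_fun setT f ->
  (forall x, 0 <= f x) ->
  (\int[density]_x (f x)%:E = \int[mu]_x (f x * p x)%:E)%E.
Proof.
move=> mf f0; rewrite ge0_integral_density//.
exact/measurable_EFinP.
Qed.

End measures_with_density.

(** * Invariance of Lebesgue integrals under u |-> - u *)

Section reflection.
Context {R : realType}.
Local Notation leb := (@lebesgue_measure R).
Let opp : measurableTypeR R -> measurableTypeR R := -%R.
Let mopp : measurable_fun setT opp. Proof. by rewrite /opp. Qed.

(** The pushforward of Lebesgue measure by the opposite map is Lebesgue measure itself. *)
Lemma integrable_reflect (f : R -> R) :
  leb.-integrable setT (EFin \o f) ->
  leb.-integrable setT (EFin \o (fun u => f (- u))).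
Proof.
move=> /integrableP[mf foo]; apply/integrableP; split.
  exact: (measurableT_comp mf mopp).
move: foo; apply: le_lt_trans.
have mf' := measurableT_comp (@abse_measurable R setT) mf.
have f'0 : {in setT, forall y : measurableTypeR R, (0 <= (abse \o (EFin \o f)) y)%E}.
  by move=> y _; exact: abse_ge0.
have := ge0_integral_pushforward mopp leb measurableT mf' f'0.
rewrite preimage_setT => <-.
rewrite le_eqVlt; apply/orP; left; apply/eqP.
by apply: eq_measure_integral => A mA _; exact: lebesgue_measureN.
Qed.

Lemma Rintegral_reflect (f : R -> R) :
  leb.-integrable setT (EFin \o f) ->
  (\int[leb]_u f (- u) = \int[leb]_u f u)%R.
Proof.
move=> intf; rewrite /Rintegral; congr fine.
have mf : measurable_fun setT (EFin \o f) by case/integrableP : intf.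
have := integral_pushforward mopp mf (integrable_reflect intf) measurableT.
rewrite preimage_setT => <- //.
by apply: eq_measure_integral => A mA _; exact: lebesgue_measureN.
Qed.

End reflection.

(** * Derivatives and a mean value bound *)

Section calculus.
Context {R : realType}.
Implicit Types (f g df h : R -> R).

Lemma is_derive_continuous f df :
  (forall v : R, is_derive v 1 f (df v)) -> continuous f.
Proof.
move=> fdf v; apply/differentiable_continuous/derivable1_diffP.
by have [d _] := fdf v; exact: d.
Qed.

Lemma is_derive_comp_mull f df (c u : R) :
  (forall v : R, is_derive v 1 f (df v)) ->
  is_derive u 1 (fun v => f (c * v)) (c * df (c * u)).
Proof.
move=> fdf; have cd : is_derive u (1:R) ( *%R c) c.
  by apply: is_derive_eq; rewrite /GRing.scale/= mulr1.
by rewrite mulrC; exact: (is_derive1_comp (fdf (c * u)) cd).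
Qed.

(** A mean value estimate, which bounds both sin v and 1 - cos v by |v|; such a linear bound offsets
    the pole 1 / u of the jump density. *)
Lemma le_normr_derive1 g h : (forall v : R, is_derive v 1 g (h v)) ->
  (forall v, `|h v| <= 1) -> g 0 = 0 -> forall v, `|g v| <= `|v|.
Proof.
move=> gh h1 g0 v; have cg := is_derive_continuous gh.
have [v0|/ltW v0] := leP 0 v.
  have [c _] := MVT_segment v0 (fun u _ => gh u) (continuous_subspaceT cg).
  by rewrite g0 !subr0 => ->; rewrite normrM ler_piMl.
have [c _] := MVT_segment v0 (fun u _ => gh u) (continuous_subspaceT cg).
by rewrite g0 !sub0r -normrN => ->; rewrite normrM normrN ler_piMl.
Qed.

Lemma continuous_divr f df (x : R) :
  (forall v : R, is_derive v 1 f (df v)) -> continuous (fun v : R => f (v / x)).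
Proof.
move=> fdf; under eq_fun do rewrite mulrC.
exact: is_derive_continuous (fun v => is_derive_comp_mull x^-1 v fdf).
Qed.

Lemma is_derive_onem_cos (v : R) : is_derive v 1 (fun u => 1 - cos u) (sin v).
Proof.
apply: (is_derive_eq (is_deriveB (is_derive_cst (1 : R) v 1) (is_derive_cos v))).
by rewrite sub0r opprK.
Qed.

Lemma is_derive_ln1sqr (v : R) :
  is_derive v 1 (fun u : R => 2^-1 * ln (1 + u ^+ 2) : R) (v / (1 + v ^+ 2)).
Proof.
have p0 : 0 < 1 + v ^+ 2 by rewrite ltr_pwDl// sqr_ge0.
have d1 : is_derive v (1 : R) (fun u : R => 1 + u ^+ 2 : R) (2 * v).
  by apply: is_derive_eq; rewrite /GRing.scale/=; ring.
have d2 := @is_derive1_comp R (@ln R) (fun u : R => 1 + u ^+ 2) v _ _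
  (is_derive1_ln p0) d1.
apply: (is_derive_eq (is_deriveZ 2^-1 d2)).
by rewrite /GRing.scale/=; field; rewrite gt_eqF.
Qed.

End calculus.

(** * Half-line integrals against e^(- a u) and e^(- a u) / u *)

Section exponential_integrals.
Context {R : realType}.
Variable a : R.
Hypothesis a0 : 0 < a.
Local Notation leb := (@lebesgue_measure R).

Lemma cvg_expR_bounded (g : R -> R) (K : R) : (forall u, `|g u| <= K) ->
  expR (- a * u) * g u @[u --> +oo] --> 0.
Proof.
move=> gK.
have E : expR (- a * u) @[u --> +oo] --> 0.
  rewrite (_ : (fun u => expR (- a * u)) =
               (fun z => expR (- z)) \o (fun z => a * z)); last first.
    by apply: eq_fun => x; rewrite mulNr.
  apply: (@cvg_comp _ _ _ _ _ _ (pinfty_nbhs R)); last exact: cvgr_expR.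
  exact: gt0_cvgMry.
have E2 : expR (- a * u) * K @[u --> +oo] --> 0 * K.
  exact: cvgMr_tmp.
rewrite mul0r in E2.
apply/norm_cvg0P; apply: (@squeeze_cvgr _ _ _ _ (cst 0) _ _ _ _ _ E2).
- apply: nearW => u /=; rewrite normr_ge0 normrM gtr0_norm ?expR_gt0//=.
  by rewrite ler_wpM2l// expR_ge0.
- exact: cvg_cst.
Qed.

(** These combinations are stable under differentiation, so e^(- a u) times one of them has an
    antiderivative of the same form; sine and cosine are thus handled together. *)
Definition trig (xi A B u : R) := A * cos (xi * u) + B * sin (xi * u).

Lemma trig_bound (xi A B u : R) : `|trig xi A B u| <= `|A| + `|B|.
Proof.
rewrite (le_trans (ler_normD _ _))// !normrM lerD//.
- by rewrite ler_piMr// cos_max.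
- by rewrite ler_piMr// sin_max.
Qed.

Lemma is_derive_exp_trig (xi P Q c u : R) :
  is_derive u 1 (fun u => expR (- a * u) * (c + trig xi P Q u))
    (expR (- a * u) * (- a * c + trig xi (xi * Q - a * P) (- a * Q - xi * P) u)).
Proof.
have de := is_derive_comp_mull (- a) u (@is_derive_expR R).
have dc := is_derive_comp_mull xi u (@is_derive_cos R).
have ds := is_derive_comp_mull xi u (@is_derive_sin R).
have dt : is_derive u 1 (trig xi P Q) (trig xi (xi * Q) (- (xi * P)) u).
  apply: (is_derive_eq (is_deriveD (is_deriveZ P dc) (is_deriveZ Q ds))).
  by rewrite /trig /GRing.scale/=; ring.
apply: (is_derive_eq (is_deriveM de (is_deriveD (is_derive_cst c u 1) dt))).
by rewrite !fctE /trig /GRing.scale/=; ring.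
Qed.

Lemma continuous_exp_trig (xi P Q c : R) :
  continuous (fun u : R => expR (- a * u) * (c + trig xi P Q u)).
Proof.
exact: is_derive_continuous (is_derive_exp_trig xi P Q c).
Qed.

Lemma measurable_exp_trig (xi P Q c : R) :
  measurable_fun setT (fun u : R => expR (- a * u) * (c + trig xi P Q u)).
Proof. by apply: continuous_measurable_fun; exact: continuous_exp_trig. Qed.

(* The constant c makes the integrand nonnegative, so that the fundamental
   theorem of calculus applies on the half-line. *)
Let ge0_integral_exp_trig (xi P Q c : R) : `|xi * Q - a * P| + `|- a * Q - xi * P| <= c ->
  (\int[leb]_(u in `[0%R, +oo[)
    (expR (- a * u) * (c + trig xi (xi * Q - a * P) (- a * Q - xi * P) u))%:E =
  (c / a - P)%:E)%E.
Proof.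
(* The constant - (c / a) is the one that differentiation turns into c. As [F] tends to 0 at
   infinity, the integral is - F 0 = c / a - P. *)
move=> ABc; pose F (u : R) : R := expR (- a * u) * (- (c / a) + trig xi P Q u).
have dF (u : R) : is_derive u 1 F
    (expR (- a * u) * (c + trig xi (xi * Q - a * P) (- a * Q - xi * P) u)).
  apply: (is_derive_eq (is_derive_exp_trig xi P Q (- (c / a)) u)).
  by congr (_ * (_ + _)); field; rewrite gt_eqF.
have dF1 (u : R) : derivable F u 1 by have [] := dF u.
rewrite (@ge0_continuous_FTC2y _ _ F 0 0).
- by rewrite /F /trig !mulr0 expR0 cos0 sin0 -EFinB; congr EFin; ring.
- move=> u _; rewrite mulr_ge0 ?expR_ge0//.
  have := trig_bound xi (xi * Q - a * P) (- a * Q - xi * P) u.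
  by rewrite ler_norml => /andP[+ _]; lra.
- exact/continuous_subspaceT/continuous_exp_trig.
- apply: (@cvg_expR_bounded _ (`|c / a| + (`|P| + `|Q|))) => u.
  by rewrite (le_trans (ler_normD _ _))// normrN lerD2l trig_bound.
- by move=> u _; exact: dF1.
- by apply: cvg_at_right_filter; exact: (is_derive_continuous dF).
- by move=> u _; rewrite derive1E; have [_ ->] := dF u.
Qed.

Local Notation D := (`]0%R, +oo[%classic : set R).

Lemma integrable_expR_cy : leb.-integrable `[0, +oo[ (EFin \o (fun u => expR (- a * u))).
Proof.
have mE : measurable_fun setT (fun u : R => expR (- a * u)).
  have := measurable_exp_trig 0 0 0 1.
  by congr (measurable_fun _ _); apply/funext => u; rewrite /trig !mul0r !addr0 mulr1.
apply/integrableP; split; first by apply/measurable_EFinP; exact: measurable_funTS.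
(* With zero frequency and coefficients and with c = 1, the integrand is the plain exponential. *)
have := @ge0_integral_exp_trig 0 0 0 1.
rewrite !mulr0 subr0 normr0 addr0 => /(_ ler01) E.
apply: le_lt_trans (ltry (1 / a - 0)); rewrite -E.
rewrite le_eqVlt; apply/orP; left; apply/eqP; apply: eq_integral => u _ /=.
by rewrite ger0_norm ?expR_ge0// /trig !mul0r !addr0 mulr1.
Qed.

Let integrable_expR : leb.-integrable D (EFin \o (fun u => expR (- a * u))).
Proof.
apply: integrableS integrable_expR_cy => //.
by apply: subset_itvr; rewrite bnd_simp.
Qed.

Let integrable_exp_trig_cy (xi A B c : R) :
  leb.-integrable `[0, +oo[ (EFin \o (fun u => expR (- a * u) * (c + trig xi A B u))).
Proof.
apply: (@le_integrable _ _ _ leb _ _ _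
  (fun u => (`|c| + (`|A| + `|B|))%:E * (expR (- a * u))%:E)%E) => //.
- by apply/measurable_EFinP; apply: measurable_funTS; exact: measurable_exp_trig.
- move=> u _ /=; rewrite lee_fin !normrM mulrC.
  rewrite ler_wpM2r// (le_trans (ler_normD _ _))//.
  by rewrite [leRHS]ger0_norm ?addr_ge0// lerD2l trig_bound.
- exact: integrableZl integrable_expR_cy.
Qed.

Let Rintegral_exp_trig (xi P Q A B : R) :
  xi * Q - a * P = A -> - a * Q - xi * P = B ->
  (\int[leb]_(u in D) (expR (- a * u) * trig xi A B u) = - P)%R.
Proof.
move=> EA EB.
have E u : expR (- a * u) * trig xi A B u = expR (- a * u) * (0 + trig xi A B u).
  by rewrite add0r.
under eq_Rintegral do rewrite E.
rewrite Rintegral_itv_obnd_cbnd; last first.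
  apply: integrableS (integrable_exp_trig_cy xi A B 0) => //.
  by apply: subset_itvr; rewrite bnd_simp.
pose c := `|A| + `|B|.
(* The shift by c makes both integrands nonnegative; their integrals are c / a - P and c / a, so c
   cancels. *)
transitivity (\int[leb]_(u in `[0%R, +oo[)
  (expR (- a * u) * (c + trig xi A B u) - expR (- a * u) * (c + trig xi 0 0 u)))%R.
  by apply: eq_Rintegral => u _; rewrite /trig; ring.
rewrite RintegralB//; [|exact: integrable_exp_trig_cy..].
rewrite /Rintegral -{1}EA -{1}EB ge0_integral_exp_trig ?EA ?EB//.
have := @ge0_integral_exp_trig xi 0 0 c.
by rewrite !mulr0 subr0 normr0 addr0 /= => -> /=; [ring|rewrite addr_ge0].
Qed.

Lemma Rintegral_exp_cos xi :
  (\int[leb]_(u in D) (expR (- a * u) * cos (xi * u)) = a / (a ^+ 2 + xi ^+ 2))%R.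
Proof.
have d0 : a ^+ 2 + xi ^+ 2 != 0 by rewrite gt_eqF// ltr_pwDl ?exprn_gt0// sqr_ge0.
(* These P and Q solve the linear system xi Q - a P = 1, - a Q - xi P = 0. *)
have := @Rintegral_exp_trig xi (- (a / (a ^+ 2 + xi ^+ 2))) (xi / (a ^+ 2 + xi ^+ 2)) 1 0.
rewrite opprK => <-; [|by field|by field].
by apply: eq_Rintegral => u _; rewrite /trig mul1r mul0r addr0.
Qed.

Lemma Rintegral_exp_sin xi :
  (\int[leb]_(u in D) (expR (- a * u) * sin (xi * u)) = xi / (a ^+ 2 + xi ^+ 2))%R.
Proof.
have d0 : a ^+ 2 + xi ^+ 2 != 0 by rewrite gt_eqF// ltr_pwDl ?exprn_gt0// sqr_ge0.
(* The same system with right-hand sides 0 and 1. *)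
have := @Rintegral_exp_trig xi (- (xi / (a ^+ 2 + xi ^+ 2))) (- (a / (a ^+ 2 + xi ^+ 2))) 0 1.
rewrite opprK => <-; [|by field|by field].
by apply: eq_Rintegral => u _; rewrite /trig mul1r mul0r add0r.
Qed.

(* The Levy density of the gamma process with unit shape and rate a. *)
Definition gamma_density (u : R) : R := \1_[set v : R | 0 < v] u / u * expR (- a * u).

Lemma gamma_density_restrict (f : R -> R) :
  (fun u => f u * gamma_density u) = (fun u => f u * (expR (- a * u) / u)) \_ D.
Proof.
apply/funext => u; rewrite patchE /gamma_density indicE.
have -> : (u \in [set v : R | 0 < v]) = (u \in D).
  by apply/idP/idP; rewrite !inE/= in_itv/= andbT.
by case: ifP => _; rewrite ?mul0r ?mulr0// mul1r [_^-1 * _]mulrC.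
Qed.

Lemma gamma_density_ge0 u : 0 <= gamma_density u.
Proof.
rewrite /gamma_density indicE mulr_ge0 ?expR_ge0//.
case: (boolP (u \in _)); rewrite ?mul0r// inE mul1r invr_ge0.
exact: ltW.
Qed.

Lemma measurable_gamma_density : measurable_fun setT gamma_density.
Proof.
have ce := is_derive_continuous
  (fun v => is_derive_comp_mull (- a) v (@is_derive_expR R)).
(* Inserting the factor 1 lets the restriction lemma apply; what remains is continuity on the open
   half-line, away from the pole at 0. *)
rewrite [gamma_density](_ : _ = (fun u => 1 * gamma_density u)); last first.
  by apply/funext => u; rewrite mul1r.
rewrite (gamma_density_restrict (fun=> 1)).
apply/(measurable_restrictT _ _).1 => //.
apply: open_continuous_measurable_fun; first exact: interval_open.
move=> u; rewrite inE/= in_itv/= andbT => u0.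
apply: cvgM; first exact: cvg_cst.
apply: cvgM; last by apply: cvgV => //; rewrite gt_eqF.
exact: ce.
Qed.

Lemma mulr_gamma_density u :
  u * gamma_density u = ((fun u => expR (- a * u)) \_ D) u.
Proof.
have := congr1 (fun f => f u) (gamma_density_restrict id) => /= ->.
rewrite !patchE; case: ifPn => // /[1!inE]/=; rewrite in_itv/= andbT => u0.
by rewrite mulrCA divff ?mulr1// gt_eqF.
Qed.

Lemma integrable_gamma_density_id :
  leb.-integrable setT (EFin \o (fun u => u * gamma_density u)).
Proof.
rewrite (_ : _ \o _ = (EFin \o (fun u => expR (- a * u))) \_ D).
  exact/(integrable_mkcond _ _).1.
by apply/funext => u; rewrite /= mulr_gamma_density restrict_EFin.
Qed.

(** Linear growth of f cancels the pole at 0, leaving the integrable exponential as dominating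
    function. *)
Lemma integrable_gamma_density (f : R -> R) (K : R) :
  measurable_fun setT f -> (forall u, `|f u| <= K * `|u|) ->
  leb.-integrable setT (EFin \o (fun u => f u * gamma_density u)).
Proof.
move=> mf fK; apply: (@le_integrable _ _ _ leb _ measurableT _
  (fun u => K%:E * (u * gamma_density u)%:E)%E).
- apply/measurable_EFinP; apply: measurable_funM => //.
  exact: measurable_gamma_density.
- move=> u _ /=; rewrite lee_fin; move: (gamma_density u) => y.
  by rewrite !normrM mulrA ler_wpM2r// (le_trans (fK u))// ler_wpM2r// ler_norm.
- exact: integrableZl integrable_gamma_density_id.
Qed.

(** Differentiation under the integral sign on ]x - 1, x + 1[: the derivative brings out a factor u,
    and as |h| <= 1 it is dominated by u [gamma_density] u, independently of the parameter. *)
Lemma is_derive_integral_gamma_density (g h : R -> R) (x : R) :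
  (forall v : R, is_derive v 1 g (h v)) -> (forall v, `|h v| <= 1) -> g 0 = 0 ->
  is_derive x 1 (fun x => \int[leb]_u (g (x * u) * gamma_density u))%R
    (\int[leb]_(u in D) (expR (- a * u) * h (x * u)))%R.
Proof.
move=> gh h1 g0.
pose f (x u : R) := g (x * u) * gamma_density u.
have df (y u : R) : is_derive y 1 (f ^~ u) (h (y * u) * (u * gamma_density u)).
  rewrite /f; under eq_fun do rewrite mulrC [_ * u]mulrC.
  apply: (is_derive_eq (is_deriveZ (gamma_density u) (is_derive_comp_mull u y gh))).
  by rewrite /GRing.scale/= [y * u]mulrC; ring.
have pf y u : partial1of2 f y u = h (y * u) * (u * gamma_density u).
  by rewrite partial1of2E; have [_ ->] := df y u.
have ug0 u : 0 <= u * gamma_density u.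
  by rewrite mulr_gamma_density patchE; case: ifP; rewrite ?expR_ge0.
have Ix : `](x - 1), (x + 1)[%classic x by rewrite /= in_itv/=; lra.
have mg : measurable_fun setT g.
  by apply: continuous_measurable_fun; exact: is_derive_continuous gh.
have intf y : `](x - 1), (x + 1)[%classic y -> leb.-integrable setT (EFin \o f y).
  move=> _; apply: (@integrable_gamma_density _ `|y|).
    by apply: measurableT_comp => //; exact: measurable_funM.
  by move=> u; rewrite -normrM; exact: le_normr_derive1 gh h1 g0 _.
have derf (y u : R) : `](x - 1), (x + 1)[%classic y -> setT u -> derivable (f ^~ u) y 1.
  by move=> _ _; have [d _] := df y u; exact: d.
have ubf (y u : R) : `](x - 1), (x + 1)[%classic y -> setT u ->
    `|partial1of2 f y u| <= u * gamma_density u.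
  by move=> _ _; rewrite pf normrM (ger0_norm (ug0 u)) ler_piMl.
apply: DeriveDef.
  exact: (derivable_under_integral measurableT Ix intf derf ug0
    integrable_gamma_density_id ubf).
rewrite -derive1E (differentiation_under_integral measurableT Ix intf derf ug0
    integrable_gamma_density_id ubf).
rewrite [RHS]Rintegral_mkcond; apply: eq_Rintegral => u _.
by rewrite pf mulr_gamma_density !patchE; case: ifP; rewrite ?mulr0// mulrC.
Qed.

(** Both sides vanish at xi = 0 and have derivative a / (a^2 + xi^2). *)
Lemma integral_sin_gamma_density (xi : R) :
  (\int[leb]_u (sin (xi * u) * gamma_density u) = atan (xi / a))%R.
Proof.
pose F x := (\int[leb]_u (sin (x * u) * gamma_density u))%R - atan (x / a).
have F' (x : R) : is_derive x 1 F 0.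
  have d1 := is_derive_integral_gamma_density x (@is_derive_sin R) (@cos_max R) (@sin0 R).
  have d2 := is_derive_comp_mull a^-1 x (@is_derive1_atan R).
  rewrite /F; under eq_fun do rewrite [_ / a]mulrC.
  apply: (is_derive_eq (is_deriveB d1 d2)).
  rewrite Rintegral_exp_cos; field.
  by rewrite !gt_eqF// ltr_pwDl ?exprn_gt0// sqr_ge0.
suff : F xi = 0 by move=> /eqP; rewrite subr_eq0 => /eqP.
rewrite (is_derive_0_is_cst xi 0 F') /F mul0r atan0 subr0.
transitivity (\int[leb]_(u in setT) (0 : R))%R.
  by apply: eq_Rintegral => u _; rewrite mul0r sin0 mul0r.
by rewrite Rintegral_cst// mul0r.
Qed.

(** Both sides vanish at xi = 0 and have derivative xi / (a^2 + xi^2). *)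
Lemma integral_cos_gamma_density (xi : R) :
  (\int[leb]_u ((1 - cos (xi * u)) * gamma_density u) =
    2^-1 * ln (1 + (xi / a) ^+ 2))%R.
Proof.
pose F x := (\int[leb]_u ((1 - cos (x * u)) * gamma_density u))%R
            - 2^-1 * ln (1 + (x / a) ^+ 2).
have F' (x : R) : is_derive x 1 F 0.
  have c0 : 1 - cos 0 = 0 :> R by rewrite cos0 subrr.
  have d1 := is_derive_integral_gamma_density x is_derive_onem_cos (@sin_max R) c0.
  have d2 := is_derive_comp_mull a^-1 x is_derive_ln1sqr.
  rewrite /F; under eq_fun do rewrite [_ / a]mulrC.
  apply: (is_derive_eq (is_deriveB d1 d2)).
  rewrite Rintegral_exp_sin; field.
  by rewrite !gt_eqF// ltr_pwDl ?exprn_gt0// sqr_ge0.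
suff : F xi = 0 by move=> /eqP; rewrite subr_eq0 => /eqP.
rewrite (is_derive_0_is_cst xi 0 F') /F mul0r expr0n/= addr0 ln1 mulr0 subr0.
transitivity (\int[leb]_(u in setT) (0 : R))%R.
  by apply: eq_Rintegral => u _; rewrite mul0r cos0 subrr mul0r.
by rewrite Rintegral_cst// mul0r.
Qed.
End exponential_integrals.

(** * The Variance-Gamma density: its rates, its integrals and its total mass *)

Section VG_density_facts.
Context {R : realType}.
Variables delta sigma alpha theta : R.
Hypotheses (sigma0 : 0 < sigma) (alpha0 : 0 < alpha) (theta0 : 0 < theta).
Local Notation leb := (@lebesgue_measure R).
Local Notation x1 := (VG_x1 delta sigma theta).
Local Notation x2 := (VG_x2 delta sigma theta).
Local Notation Pi := (VG_Pi delta sigma alpha theta).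

Let e : R := 2 / (theta * sigma ^+ 2).
Let D : R := delta / sigma ^+ 2.

Let e0 : 0 < e.
Proof. by rewrite divr_gt0// mulr_gt0// exprn_gt0. Qed.

Let D2 : delta ^+ 2 / sigma ^+ 4 = D ^+ 2.
Proof. by rewrite /D; field; rewrite gt_eqF. Qed.

(** The rates are [D] plus and minus this square root, so the strict inequality, due to e > 0, gives
    them opposite signs. *)
Let lt_sqrt : `|D| < Num.sqrt (D ^+ 2 + e).
Proof. by rewrite -sqrtr_sqr ltr_sqrt ?ltrDl// ltr_wpDl// sqr_ge0. Qed.

Lemma VG_x1_gt0 : 0 < x1.
Proof.
by rewrite /VG_x1 D2 -/D -/e; move: lt_sqrt; rewrite ltr_norml => /andP[]; lra.
Qed.

Lemma VG_x2_lt0 : x2 < 0.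
Proof.
by rewrite /VG_x2 D2 -/D -/e; move: lt_sqrt; rewrite ltr_norml => /andP[]; lra.
Qed.

(** The sum and the product of the rates determine the coefficients of (1 + i xi / x1) (1 + i xi /
    x2). *)
Lemma VG_x1Dx2 : x1 + x2 = 2 * delta / sigma ^+ 2.
Proof. by rewrite /VG_x1 /VG_x2; lra. Qed.

Lemma VG_x1Mx2 : x1 * x2 = - (2 / (theta * sigma ^+ 2)).
Proof.
rewrite /VG_x1 /VG_x2 mulrC -subr_sqr D2 -/D -/e sqr_sqrtr; first by ring.
by rewrite addr_ge0 ?sqr_ge0// ltW.
Qed.

Let Nx2 : 0 < - x2. Proof. by rewrite oppr_gt0 VG_x2_lt0. Qed.

(** Splitting into one-sided gamma densities with the positive rates [x1] and [- x2] reduces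
    integrals against [Pi] to half-line integrals. *)
Lemma VG_PiE u :
  Pi u = alpha * (gamma_density x1 u + gamma_density (- x2) (- u)).
Proof.
rewrite /VG_Pi /gamma_density opprK mulrN mulNr; congr (_ * (_ + _)).
rewrite !indicE; have -> : (u \in [set v : R | v < 0]) = (- u \in [set v | 0 < v]).
  by apply/idP/idP; rewrite !inE/= oppr_gt0.
case: (boolP (- u \in _)); rewrite ?mul0r// inE/= oppr_gt0 => u0.
by rewrite ltr0_norm// mulNr.
Qed.

Lemma VG_Pi_ge0 u : 0 <= Pi u.
Proof.
rewrite VG_PiE; apply: mulr_ge0; first exact: ltW.
by apply: addr_ge0; exact: gamma_density_ge0.
Qed.

Lemma measurable_VG_Pi : measurable_fun setT Pi.
Proof.
rewrite (funext VG_PiE); apply: measurable_funM => //; apply: measurable_funD.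
  exact: measurable_gamma_density.
by apply: measurableT_comp => //; exact: measurable_gamma_density.
Qed.

(** * Integrals against [Pi] of functions bounded by a multiple of |u| *)

Section linear_growth.
Variables (f : R -> R) (K : R).
Hypotheses (mf : measurable_fun setT f) (fK : forall u, `|f u| <= K * `|u|).

(** The second summand is displayed as a function of - u, the form required by the reflection
    lemmas. *)
Let VG_PiM : (fun u => f u * Pi u) = fun u => alpha *
  (f u * gamma_density x1 u + (fun v => f (- v) * gamma_density (- x2) v) (- u)).
Proof. by apply/funext => u; rewrite VG_PiE opprK; ring. Qed.

Let int1 : leb.-integrable setT (EFin \o (fun u => f u * gamma_density x1 u)).
Proof. exact: integrable_gamma_density VG_x1_gt0 _ _ mf fK. Qed.

Let int2 :
  leb.-integrable setT (EFin \o (fun v => f (- v) * gamma_density (- x2) v)).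
Proof.
apply: (integrable_gamma_density Nx2 (K := K)).
  exact: measurableT_comp.
by move=> u; rewrite (le_trans (fK _))// normrN.
Qed.

Let intD : leb.-integrable setT (EFin \o (fun u => f u * gamma_density x1 u +
  (fun v => f (- v) * gamma_density (- x2) v) (- u))).
Proof. exact: (integrableD measurableT int1 (integrable_reflect int2)). Qed.

Lemma integrable_VG_Pi : leb.-integrable setT (EFin \o (fun u => f u * Pi u)).
Proof. by rewrite VG_PiM; exact: (integrableZl measurableT alpha intD). Qed.

Lemma Rintegral_VG_Pi : (\int[leb]_u (f u * Pi u) =
  alpha * (\int[leb]_u (f u * gamma_density x1 u) +
           \int[leb]_u (f (- u) * gamma_density (- x2) u)))%R.
Proof.
rewrite VG_PiM RintegralZl// RintegralD//; last exact: integrable_reflect int2.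
by congr (_ * (_ + _)); rewrite (Rintegral_reflect int2).
Qed.

End linear_growth.

Let le_sin (xi u : R) : `|sin (xi * u)| <= `|xi| * `|u|.
Proof.
by rewrite -normrM; exact: le_normr_derive1 (@is_derive_sin R) (@cos_max R) (@sin0 R) _.
Qed.

Let le_cos (xi u : R) : `|1 - cos (xi * u)| <= `|xi| * `|u|.
Proof.
rewrite -normrM; apply: (le_normr_derive1 is_derive_onem_cos (@sin_max R)).
by rewrite cos0 subrr.
Qed.

Let msin (xi : R) : measurable_fun setT (fun u : R => sin (xi * u)).
Proof.
by apply: measurableT_comp => //; apply: continuous_measurable_fun; exact: continuous_sin.
Qed.

Let mcos (xi : R) : measurable_fun setT (fun u : R => cos (xi * u)).
Proof.
by apply: measurableT_comp => //; apply: continuous_measurable_fun; exact: continuous_cos.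
Qed.

Let m1cos (xi : R) : measurable_fun setT (fun u : R => 1 - cos (xi * u)).
Proof. exact: measurable_funB. Qed.

Lemma integrable_sin_VG_Pi xi :
  leb.-integrable setT (EFin \o (fun u => sin (xi * u) * Pi u)).
Proof. exact: integrable_VG_Pi (msin xi) (le_sin xi). Qed.

Lemma integrable_cos_VG_Pi xi :
  leb.-integrable setT (EFin \o (fun u => (1 - cos (xi * u)) * Pi u)).
Proof. exact: integrable_VG_Pi (m1cos xi) (le_cos xi). Qed.

Lemma integral_sin_VG_Pi xi :
  (\int[leb]_u (sin (xi * u) * Pi u) = alpha * (atan (xi / x1) + atan (xi / x2)))%R.
Proof.
rewrite (Rintegral_VG_Pi (msin xi) (le_sin xi)) integral_sin_gamma_density ?VG_x1_gt0//.
(* On the negative side the sign of u is absorbed into xi, and (- xi) / (- x2) = xi / x2. *)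
congr (_ * (_ + _)); under eq_Rintegral do rewrite mulrN -mulNr.
by rewrite integral_sin_gamma_density// invrN mulrNN.
Qed.

Lemma integral_cos_VG_Pi xi : (\int[leb]_u ((1 - cos (xi * u)) * Pi u) =
  alpha * (2^-1 * ln (1 + (xi / x1) ^+ 2) + 2^-1 * ln (1 + (xi / x2) ^+ 2)))%R.
Proof.
rewrite (Rintegral_VG_Pi (m1cos xi) (le_cos xi)) integral_cos_gamma_density ?VG_x1_gt0//.
congr (_ * (_ + _)); under eq_Rintegral do rewrite mulrN -mulNr.
by rewrite integral_cos_gamma_density// invrN mulrNN.
Qed.

(** This is [Clog_mul] at p = xi / x1 and q = xi / x2; the product p q = - sigma^2 theta xi^2 / 2
    yields both the sign condition and the real part. *)
Lemma Clog_VG xi :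
  Clog (1 - 'i%R * (delta * theta * xi)%:C
            + (2^-1 * sigma ^+ 2 * theta * xi ^+ 2)%:C) =
  (2^-1 * ln (1 + (xi / x1) ^+ 2) + 2^-1 * ln (1 + (xi / x2) ^+ 2))
  +i* (atan (xi / x1) + atan (xi / x2)).
Proof.
have x1n : x1 != 0 by rewrite gt_eqF// VG_x1_gt0.
have x2n : x2 != 0 by rewrite lt_eqF// VG_x2_lt0.
have sn : sigma != 0 by rewrite gt_eqF.
have tn : theta != 0 by rewrite gt_eqF.
have M : xi / x1 * (xi / x2) = - (2^-1 * sigma ^+ 2 * theta * xi ^+ 2).
  have -> : xi / x1 * (xi / x2) = xi ^+ 2 / (x1 * x2) by field; rewrite ?x1n ?x2n.
  by rewrite VG_x1Mx2; field; rewrite ?sn ?tn.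
rewrite -Clog_mul; last first.
  rewrite M oppr_le0 mulr_ge0 ?sqr_ge0// mulr_ge0 ?(ltW theta0)//.
  by rewrite mulr_ge0 ?sqr_ge0// invr_ge0.
congr Clog; rewrite imaginaryE oneCE !mulcE oppcE !addcE; congr (_ +i* _).
  by rewrite M; ring.
have -> : xi / x1 + xi / x2 = xi * (x1 + x2) / (x1 * x2).
  by field; rewrite ?x1n ?x2n.
by rewrite VG_x1Dx2 VG_x1Mx2; field; rewrite ?sn ?tn.
Qed.

Lemma integral_min_VG_Pi :
  (\int[leb]_u (Num.min 1 `|u| * Pi u)%:E < +oo)%E.
Proof.
apply: integrable_lty => //.
apply: (@integrable_VG_Pi (fun u => Num.min 1 `|u|) 1).
  by apply: measurable_minr => //; exact: measurableT_comp.
move=> u; rewrite mul1r ger0_norm ?le_min ?ler01 ?normr_ge0//.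
by rewrite ge_min lexx orbT.
Qed.

(* Otherwise the integrals of (1 - cos (xi u)) Pi u would be bounded in xi,
   whereas they grow like ln xi. *)
Lemma integral_VG_Pi_oo : (\int[leb]_u (Pi u)%:E = +oo)%E.
Proof.
apply/eqP; rewrite -leye_eq leNgt; apply/negP => Pioo.
have intPi : leb.-integrable setT (EFin \o Pi).
  apply/integrableP; split; first by apply/measurable_EFinP; exact: measurable_VG_Pi.
  move: Pioo; apply: le_lt_trans; rewrite le_eqVlt; apply/orP; left; apply/eqP.
  by apply: eq_integral => u _; rewrite /= ger0_norm// VG_Pi_ge0.
pose W := (\int[leb]_u (2 * Pi u))%R.
have int2Pi : leb.-integrable setT (EFin \o (fun u => 2 * Pi u)).
  exact: (integrableZl measurableT 2 intPi).
(* The nonnegative logarithm in [x2] is dropped, and 1 - cos is at most 2. *)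
have bounded (xi : R) : alpha * (2^-1 * ln (1 + (xi / x1) ^+ 2)) <= W.
  apply: (@le_trans _ _ (\int[leb]_u ((1 - cos (xi * u)) * Pi u))%R).
    rewrite integral_cos_VG_Pi ler_wpM2l ?(ltW alpha0)// lerDl mulr_ge0//.
    by rewrite ln_ge0// lerDl sqr_ge0.
  apply: le_Rintegral => //; first exact: integrable_cos_VG_Pi.
  move=> u _; rewrite ler_wpM2r ?VG_Pi_ge0//.
  by have := cos_geN1 (xi * u); lra.
(* At xi = x1 e^m the left-hand side of [bounded] is at least alpha m = W + alpha, which exceeds
   [W]. *)
pose m := W / alpha + 1.
have := bounded (x1 * expR m).
rewrite [_ * expR m]mulrC mulfK ?gt_eqF ?VG_x1_gt0// leNgt => /negP; apply.
have : ln (expR m ^+ 2) <= ln (1 + expR m ^+ 2).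
  by rewrite ler_ln ?posrE ?lerDr ?ltr_wpDl ?exprn_gt0 ?expR_gt0.
rewrite lnXn ?expR_gt0// expRK => lnm.
have : alpha * m <= alpha * (2^-1 * ln (1 + expR m ^+ 2)).
  by rewrite ler_pM2l//; lra.
apply: lt_le_trans; rewrite /m mulrDr mulr1 mulrCA divff ?gt_eqF// mulr1.
by rewrite ltrDl.
Qed.

End VG_density_facts.

(** * Cartesian form of the integrands, and assembly of the representation *)

Lemma integrandE (R : realType) (xi u p : R) :
  (1 - Cexp (- 'i%R * (xi * u)%:C)) * p%:C
  = ((1 - cos (xi * u)) * p) +i* (sin (xi * u) * p).
Proof.
rewrite mulNr.
rewrite -[- ('i%R * _)]mulrN -rmorphN Cexp_iE cosN sinN oneCE oppcE addcE mulcE.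
by rewrite !mulr0 subr0 sub0r opprK add0r.
Qed.

(** Here p stands for the value at u of the indicator of [-1, 1]. *)
Lemma compensated_integrandE (R : realType) (xi u p : R) :
  Cexp ('i%R * (xi * u)%:C) - 1 - 'i%R * (xi * u * p)%:C
  = (cos (xi * u) - 1) +i* (sin (xi * u) - xi * (u * p)).
Proof.
rewrite Cexp_iE oneCE imaginaryE !mulcE !oppcE !addcE.
by congr (_ +i* _); ring.
Qed.

(* VG_Pi enters the first formula through exp(- i xi u), so in the standard
   sign convention, where the Levy density at u is the arrival rate of jumps of
   size + u, the Levy density of Y is the reflected function u |-> Pi (- u). *)
Theorem theorem3p2 (R : realType) (d : measure_display) (T : measurableType d)
    (P : probability T R) (mu delta sigma alpha theta : R)
    (Y : R -> {RV P >-> R}) :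
  0 < sigma -> 0 < alpha -> 0 < theta ->
  is_VG_process mu delta sigma alpha theta Y ->
  let Pi := VG_Pi delta sigma alpha theta in
  [/\ is_dlog (cf P (Y 1)) (fun xi => - char_exponent Y xi 1),
      forall xi : R,
        Cintegrable lebesgue_measure
          (fun u : R => (1 - Cexp (- 'i * (xi * u)%:C)) * (Pi u)%:C) /\
        char_exponent Y xi 1 =
          - 'i * (mu * xi)%:C
          + Cintegral lebesgue_measure
              (fun u : R => (1 - Cexp (- 'i * (xi * u)%:C)) * (Pi u)%:C),
      is_levy_density Y (fun u => Pi (- u)),
      (\int[lebesgue_measure]_u (Pi u)%:E = +oo)%E &
      (\int[lebesgue_measure]_u (Num.min 1 `|u| * Pi u)%:E < +oo)%E].
Proof.
move=> s0 a0 t0 [_ cfE] Pi.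
pose x1 := VG_x1 delta sigma theta.
pose x2 := VG_x2 delta sigma theta.
(* [L] and [A] are the real and imaginary parts of the principal logarithm of the polynomial in the
   characteristic function. *)
pose L xi := 2^-1 * ln (1 + (xi / x1) ^+ 2) + 2^-1 * ln (1 + (xi / x2) ^+ 2).
pose A xi := atan (xi / x1) + atan (xi / x2).
(* Time 1 serves for the distinguished logarithm, all times t >= 0 for the Levy-Khintchine
   formula. *)
have cfY t xi : 0 <= t -> cf P (Y t) xi =
    Cexp (t%:C * ((- (alpha * L xi)) +i* (mu * xi - alpha * A xi))).
  move=> t_ge0; rewrite cfE// /Cpow Clog_VG// -CexpN -CexpD; congr Cexp.
  rewrite imaginaryE !mulcE oppcE addcE.
  by congr (_ +i* _); rewrite /L /A -/x1 -/x2; ring.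
have intE (xi : R) : Cintegral lebesgue_measure
    (fun u : R => (1 - Cexp (- 'i * (xi * u)%:C)) * (Pi u)%:C) =
    (alpha * L xi) +i* (alpha * A xi).
  rewrite /Cintegral; congr (_ +i* _).
  - rewrite -integral_cos_VG_Pi//; apply: eq_Rintegral => u _.
    by rewrite integrandE.
  - rewrite -integral_sin_VG_Pi//; apply: eq_Rintegral => u _.
    by rewrite integrandE.
have cL : continuous L.
  by move=> xi; apply: cvgD; exact: continuous_divr (@is_derive_ln1sqr R) xi.
have cA : continuous A.
  by move=> xi; apply: cvgD; exact: continuous_divr (@is_derive1_atan R) xi.
pose g xi := (- (alpha * L xi)) +i* (mu * xi - alpha * A xi).
have dl : is_dlog (cf P (Y 1)) g.
  split => /=.
  - by move=> xi; apply: cvgN; apply: cvgM; [exact: cvg_cst|exact: cL].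
  - move=> xi; apply: cvgB; first by apply: cvgM; [exact: cvg_cst|exact: cvg_id].
    by apply: cvgM; [exact: cvg_cst|exact: cA].
  - by rewrite /g /L /A !mul0r expr0n/= !addr0 ln1 atan0 !mulr0 addr0 !mulr0 subr0 oppr0.
  - by move=> xi; rewrite cfY// mul1r.
have ceE xi : char_exponent Y xi 1 = - g xi.
  by rewrite /char_exponent (dlogE dl).
split.
- have -> // : (fun xi => - char_exponent Y xi 1) = g.
  by apply/funext => xi; rewrite ceE opprK.
- move=> xi; split.
    split.
    + have := integrable_cos_VG_Pi delta alpha s0 t0 xi.
      by congr (integrable _ _ _); apply/funext => u; rewrite integrandE.
    + have := integrable_sin_VG_Pi delta alpha s0 t0 xi.
      by congr (integrable _ _ _); apply/funext => u; rewrite integrandE.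
  rewrite ceE /g intE imaginaryE !oppcE mulcE addcE.
  by congr (_ +i* _); ring.
- have mPi := measurable_VG_Pi delta sigma alpha theta.
  have mq : measurable_fun setT (fun u : R => Pi (- u)) by exact: measurableT_comp.
  have q0 u : 0 <= Pi (- u) by exact: VG_Pi_ge0.
  split=> //; exists (density_measure lebesgue_measure mq q0) => //.
  (* The compensator of small jumps. Being bounded by |u|, it is integrable against the jump density
     and can be moved into the drift. *)
  pose tr (u : R) : R := u * \1_[set v : R | `|v| <= 1] u.
  have mtr : measurable_fun setT tr.
    apply: measurable_funM => //; apply: measurable_indic.
    rewrite (_ : [set v : R | `|v| <= 1] = `[-1, 1]%classic)//.
    by apply/seteqP; split=> v /=; rewrite in_itv/= ler_norml.
  have letr u : `|tr (- u)| <= 1 * `|u|.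
    rewrite mul1r /tr indicE normrM normrN.
    by case: (_ \in _); rewrite ?normr1 ?normr0 ?mulr1 ?mulr0.
  have int_tr : lebesgue_measure.-integrable setT
      (EFin \o (fun u => tr u * Pi (- u))).
    have mtrN : measurable_fun setT (fun u : R => tr (- u)) by exact: measurableT_comp.
    have := integrable_reflect (integrable_VG_Pi delta alpha s0 t0 mtrN letr).
    by congr (integrable _ _ _); apply/funext => u /=; rewrite opprK.
  split.
  + exact: integral_set1.
  + pose f (u : R) : R := Num.min 1 (u ^+ 2).
    have mf : measurable_fun setT f.
      by apply: measurable_minr => //; exact: measurable_funX.
    have f0 u : 0 <= f u by rewrite le_min ler01 sqr_ge0.
    (* If |u| <= 1 then u^2 <= |u|; otherwise 1 <= |u|. *)
    have lef u : `|f u| <= 1 * `|u|.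
      rewrite mul1r ger0_norm// /f ge_min -(real_normK (num_real u)).
      have [u1|u1] := leP `|u| 1; last by rewrite (ltW u1).
      by rewrite expr2 ler_piMl ?orbT.
    rewrite ge0_integral_density_EFin//.
    apply: integrable_lty => //.
    have := integrable_reflect (integrable_VG_Pi delta alpha s0 t0 mf lef).
    congr (integrable _ _ _); apply/funext => u /=.
    by rewrite /f sqrrN.
  (* The drift adds back the integral of the compensator to [mu], and there is no Gaussian part. *)
  + exists (mu + \int[lebesgue_measure]_u (tr u * Pi (- u)))%R, 0; split => // t xi t_ge0.
    rewrite cfY//; congr (Cexp (_ * _)).
    have int_sin := integrable_reflect (integrable_sin_VG_Pi delta alpha s0 t0 xi).
    have int_cos := integrable_reflect (integrable_cos_VG_Pi delta alpha s0 t0 xi).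
    have ReE : (\int[lebesgue_measure]_u ((cos (xi * u) - 1) * Pi (- u)) =
        - (alpha * L xi))%R.
      rewrite -integral_cos_VG_Pi// -(Rintegral_reflect (integrable_cos_VG_Pi _ _ _ _ xi))//.
      rewrite -[in RHS]mulN1r -RintegralZl//; apply: eq_Rintegral => u _.
      by rewrite /Pi mulrN cosN; ring.
    (* Since the sine is odd, reflecting the density changes the sign of its integral, which
       produces the - alpha A required by [cfY]; the cosine part is even and keeps its value. *)
    have ImE : (\int[lebesgue_measure]_u ((sin (xi * u) - xi * tr u) * Pi (- u)) =
        - (alpha * A xi) - xi * \int[lebesgue_measure]_u (tr u * Pi (- u)))%R.
      rewrite -integral_sin_VG_Pi// -(Rintegral_reflect (integrable_sin_VG_Pi _ _ _ _ xi))//.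
      rewrite -[in RHS]mulN1r -!RintegralZl// -RintegralB//.
      * by apply: eq_Rintegral => u _; rewrite /Pi mulrN sinN; ring.
      * exact: integrableZl int_sin.
      * exact: integrableZl int_tr.
    have mcos : measurable_fun setT (fun u : R => cos (xi * u) - 1).
      apply: measurable_funB => //; apply: measurableT_comp => //.
      by apply: continuous_measurable_fun; exact: continuous_cos.
    have msin : measurable_fun setT (fun u : R => sin (xi * u) - xi * tr u).
      apply: measurable_funB; last exact: measurable_funM.
      apply: measurableT_comp => //.
      by apply: continuous_measurable_fun; exact: continuous_sin.
    have -> : Cintegral (density_measure lebesgue_measure mq q0) (fun u : R =>
        Cexp ('i%R * (xi * u)%:C) - 1
          - 'i%R * (xi * u * \1_[set v : R | `|v| <= 1] u)%:C) =
        (- (alpha * L xi)) +i*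
        (- (alpha * A xi) - xi * \int[lebesgue_measure]_u (tr u * Pi (- u))).
      rewrite -ReE -ImE -(Rintegral_density lebesgue_measure mq q0 mcos).
      rewrite -(Rintegral_density lebesgue_measure mq q0 msin).
      rewrite /Cintegral; congr (_ +i* _);
        by apply: eq_Rintegral => u _; rewrite compensated_integrandE.
    rewrite imaginaryE !mulcE !oppcE !addcE.
    by congr (_ +i* _); ring.
- exact: integral_VG_Pi_oo.
- exact: integral_min_VG_Pi.
Qed.
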